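(* Let $\Delta=\{z\in\mathbb{C}:|z|<1\}$. The complex manifold $X=\Delta\times\mathbb{C}$ admits inequivalent tame discrete subsets; that is, there exist tame discrete subsets $D,D'\subset X$ such that no automorphism $\phi$ of $X$ satisfies $\phi(D)=D'$.
   Context: A discrete subset of a complex manifold $X$ is a subset without accumulation points in $X$. An automorphism of $X$ is a biholomorphic self-map of $X$. An exhaustion function on $X$ is a continuous function $\rho:X\to\mathbb{R}^+$ (non-negative reals) all of whose sublevel sets $\{x\in X:\rho(x)\le c\}$ are compact. An infinite discrete subset $D\subset X$ is called tame if for every exhaustion function $\rho:X\to\mathbb{R}^+$ and every map $\zeta:D\to\mathbb{R}^+$ there exists an automorphism $\phi$ of $X$ such that $\rho(\phi(x))\ge\zeta(x)$ for all $x\in D$. Two subsets of $X$ are equivalent if some automorphism of $X$ maps one onto the other. *)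

(* Defs.v *)
From HB Require Import structures.
From mathcomp Require Import all_boot all_order all_algebra.
From mathcomp Require Import complex.
From mathcomp Require Import all_classical all_reals all_analysis.
Set Implicit Arguments.
Unset Strict Implicit.
Unset Printing Implicit Defensive.
Import Order.TTheory GRing.Theory Num.Theory.
Import numFieldNormedType.Exports.
Local Open Scope classical_set_scope.
Local Open Scope ring_scope.

(* R[i] seen as a numClosedFieldType, so that it gets the norm and topology
   that every numFieldType has over itself.  Its norm `|z| is the complex
   modulus, valued in the real elements of R[i]; on real elements the partial
   order of R[i] is the usual one. *)
Definition Cplx (R : realType) : numClosedFieldType := R[i].

(* In what follows a complex manifold is an open subset X of a normed complex
   vector space V; maps and functions on X are total functions on V of which
   only the restriction to X matters. *)

Definition discrete_in (T : topologicalType) (X D : set T) : Prop :=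
  D `<=` X /\ forall x, X x -> ~ limit_point D x.

Section Manifold.
Variables (R : realType) (V : normedModType (Cplx R)).
Implicit Types (X D : set V).

(* differentiability over the scalar field Cplx R, hence with a
   complex-linear differential *)
Definition holomorphic_on (W : normedModType (Cplx R)) X (f : V -> W) : Prop :=
  forall x, X x -> differentiable f x.

Definition automorphism X (phi : V -> V) : Prop :=
  [/\ set_fun X X phi, holomorphic_on X phi &
      exists psi : V -> V,
        [/\ set_fun X X psi, holomorphic_on X psi,
            {in X, cancel phi psi} & {in X, cancel psi phi}]].

Definition exhaustion X (rho : V -> R) : Prop :=
  [/\ forall x, X x -> 0 <= rho x,
      {within X, continuous rho} &
      forall c : R, compact (X `&` [set x | rho x <= c])].

Definition tame X D : Prop :=
  [/\ discrete_in X D, infinite_set D &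
      forall (rho : V -> R) (zeta : V -> R),
        exhaustion X rho -> (forall x, D x -> 0 <= zeta x) ->
        exists2 phi, automorphism X phi &
          forall x, D x -> zeta x <= rho (phi x)].

Definition equivalent_in X D D' : Prop :=
  exists2 phi, automorphism X phi & phi @` D = D'.

End Manifold.

Definition unit_disc (R : realType) : set (Cplx R) := [set z | `|z| < 1].
Arguments unit_disc : clear implicits.

Definition disc_times_C (R : realType) : set (Cplx R * Cplx R) :=
  unit_disc R `*` [set: Cplx R].
Arguments disc_times_C : clear implicits.

(* Main.v *)
Require Import Defs.
From mathcomp Require Import all_boot all_order all_algebra.
From mathcomp Require Import all_classical all_reals all_analysis.
Import numFieldNormedType.Exports.
From mathcomp Require Import complex ring lra.

(** The disc is bounded while the fibres of the projection to it are complex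
    lines.  If [phi] is an automorphism of the product, its first coordinate
    restricted to a fibre is a bounded entire function, hence constant: every
    automorphism permutes the fibres ([automorphism_fibres]).  So the number
    of points that a discrete set has over one point of the disc is visible to
    automorphisms.  Fix a sequence [node k] in the disc increasing to 1; the
    set [two_rows], with two points over each node, cannot be mapped onto
    [one_row], with a single point over each node.

    Both sets are tame ([tame_two_rows]).  Given an exhaustion [rho], the set
    where [rho] is at most [c] is compact, hence bounded in the second
    coordinate, so a point over [node k] is moved as far as desired for [rho]
    by a shear [(z, w) |-> (z, w + b z)] as soon as [b (node k)] is large
    enough.  It remains to find [b] holomorphic on the disc with prescribed
    growth along the nodes ([fast_growing_holomorphic]).  A series of
    monomials [c_k z ^ m_k] does this: the [k]-th one is at most [2 ^ - k] at
    [radius k] and as large as desired at [node k = radius k.+1], which a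
    large exponent allows since the ratio of these radii is greater than 1.  All
    coefficients being nonnegative, the other monomials only increase the
    value at a node.

    Liouville's theorem is proved for functions that are merely differentiable
    at each point, without integrals.  The contour integral along a segment is
    replaced by trapezoid sums over [3 ^ m] equal pieces ([trapsum]), which
    are exact on affine functions and additive under division in three.
    Goursat's subdivision argument then shows that the sums along the boundary
    of a square on which [f] is differentiable tend to 0 with [m] ([goursat]).
    Applied to [g z = (f z - f 0 - f' 0 * z) / z ^ 2] on large squares around
    the singular point 0 ([punctured_loopsum]), it gives [f' 0 = 0] for
    bounded [f], because the sums of [1 / z] stay away from 0
    ([loopsum_inv]).  By translation [f' = 0] everywhere, and [f] is
    constant. *)

Set Implicit Arguments.
Unset Strict Implicit.
Unset Printing Implicit Defensive.
Import Normc Order.TTheory GRing.Theory Num.Theory.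
Local Open Scope classical_set_scope.
Local Open Scope ring_scope.
Local Open Scope complex_scope.

Local Notation Re := complex.Re.
Local Notation Im := complex.Im.

(** * The modulus as a real number *)
Section Modulus.
Variable R : realType.
Implicit Types z w : R[i].

Lemma modD z w : normc (z + w) <= normc z + normc w.
Proof. exact: (@le_normcD R z w). Qed.

Lemma modN z : normc (- z) = normc z.
Proof. exact: (@normcN R z). Qed.

Lemma modB z w : normc (z - w) <= normc z + normc w.
Proof. by rewrite -(modN w); exact: modD. Qed.

Lemma mod_distC z w : normc (z - w) = normc (w - z).
Proof. by rewrite -modN opprB. Qed.

Lemma mod_ge0 z : 0 <= normc z.
Proof. by case: z => a b; exact: sqrtr_ge0. Qed.

Lemma mod_real (x : R) : normc x%:C = `|x|.
Proof. by rewrite /normc /= expr0n /= addr0 sqrtr_sqr. Qed.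

Lemma mod_nat n : normc (n%:R : R[i]) = n%:R.
Proof. by rewrite -[n%:R in LHS](rmorph_nat (real_complex R)) mod_real ger0_norm. Qed.

Lemma mod_gt0 z : z != 0 -> 0 < normc z.
Proof.
by rewrite lt_neqAle mod_ge0 andbT => /eqP z0; apply/eqP => /esym/eq0_normc.
Qed.

Lemma modX z n : normc (z ^+ n) = normc z ^+ n.
Proof. by elim: n => [|n IH]; rewrite ?expr0 ?normc1 // !exprS normcM IH. Qed.

(** The norm of [R[i]] takes its values in [R[i]], whose order is partial;
    the estimates below are made on [normc] instead, in the ordered field
    [R]. *)
Lemma norm_mod z : `|z| = real_complex R (normc z).
Proof. by case: z. Qed.

Lemma cartesian z : z = (Re z)%:C + 'i * (Im z)%:C.
Proof. by have := complexE z; rewrite complexiE. Qed.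

Lemma mod_i : normc ('i%R : R[i]) = 1.
Proof. by rewrite -[LHS]/(normc (0 +i* 1)) /normc expr0n expr1n add0r sqrtr1. Qed.

Lemma Re_le_mod z : `|Re z| <= normc z.
Proof. by have := normc_ge_Re z; rewrite norm_mod lecR. Qed.

Lemma Im_le_mod z : `|Im z| <= normc z.
Proof.
case: z => a b /=; rewrite -[leLHS]sqrtr_sqr ler_wsqrtr //.
by rewrite lerDr sqr_ge0.
Qed.

Lemma mod_le_ReIm z : normc z <= `|Re z| + `|Im z|.
Proof.
rewrite {1}[z]cartesian (le_trans (modD _ _)) // normcM mod_i mul1r.
by rewrite !mod_real.
Qed.

Lemma mod_sum (I : finType) (F : I -> R[i]) (G : I -> R) :
  (forall i, normc (F i) <= G i) -> normc (\sum_i F i) <= \sum_i G i.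
Proof.
move=> FG; elim/big_ind2: _ => [|x x' y y' xx yy|i _]; last exact: FG.
  by rewrite normc0.
exact: le_trans (modD _ _) (lerD xx yy).
Qed.

End Modulus.

(** * Division of the unit square in ninths *)
Section Cousin.
Variable R : realType.

(** Bernoulli's inequality and the Archimedean property. *)
Lemma expr_unbounded (q B : R) : 1 < q -> exists n, B < q ^+ n.
Proof.
move=> q1; have bern n : 1 + n%:R * (q - 1) <= q ^+ n.
  elim: n => [|n IH]; first by rewrite mul0r addr0.
  rewrite exprS -natr1; have : 0 <= n%:R :> R by [].
  move: IH; set a := q ^+ n; set b := n%:R => IH b0.
  have : 0 <= b * ((q - 1) * (q - 1)) by rewrite !mulr_ge0 // subr_ge0 ltW.
  have : 0 <= q * (a - (1 + b * (q - 1))).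
    by rewrite mulr_ge0 ?subr_ge0 // ltW // (lt_trans ltr01).
  by lra.
have [n Bn] : exists n : nat, B / (q - 1) < n%:R.
  by exists (Num.bound (B / (q - 1))); exact: unstable.ltr_bound.
exists n; apply: lt_le_trans (bern n).
by move: Bn; rewrite ltr_pdivrMr ?subr_gt0 //; lra.
Qed.

Lemma nested_cells (u h : nat -> R) :
  (forall n, u n <= u n.+1) -> (forall n, u n.+1 + h n.+1 <= u n + h n) ->
  (forall n, 0 <= h n) -> exists p, forall n, u n <= p <= u n + h n.
Proof.
move=> uS hS h0.
have um m n : (m <= n)%N -> u m <= u n by exact: (homo_leq lexx le_trans).
have vm m n : (m <= n)%N -> u n + h n <= u m + h m.
  apply: (homo_leq (f := fun n => u n + h n) (r := fun x y => y <= x)) => //.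
  by move=> y x z xy yz; exact: le_trans yz xy.
have ub n : ubound (range u) (u n + h n).
  move=> _ [m _ <-]; have [mn|/ltnW nm] := leqP m n.
    by rewrite (le_trans (um _ _ mn)) // lerDl.
  by rewrite (le_trans _ (vm _ _ nm)) // lerDl.
have ne : range u !=set0 by exists (u 0%N), 0%N.
exists (sup (range u)) => n; apply/andP; split; last exact: ge_sup (ub n).
apply: sup_upper_bound; last by exists n.
by split=> //; exists (u 0%N + h 0%N); exact: ub.
Qed.

(** Cousin's lemma for the unit square and its divisions in thirds: a property
    of the cells [[x, x + 3^-n] * [y, y + 3^-n]] that passes from the nine
    parts of a cell to the cell, and that holds for the small cells around
    each point, holds for the whole square.  Otherwise there would be a
    nested sequence of cells without the property, shrinking to a point. *)
Lemma cousin (P : nat -> R -> R -> Prop) :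
  (forall n x y,
    (forall i j : 'I_3, P n.+1 (x + i%:R / 3 ^+ n.+1) (y + j%:R / 3 ^+ n.+1)) ->
    P n x y) ->
  (forall p q, 0 <= p <= 1 -> 0 <= q <= 1 -> exists2 d : R, 0 < d &
    forall n x y, (3 ^+ n)^-1 < d ->
      x <= p <= x + (3 ^+ n)^-1 -> y <= q <= y + (3 ^+ n)^-1 -> P n x y) ->
  P 0 0 0.
Proof.
move=> Psub Ploc; apply: contrapT => nP.
pose step (s t : nat * (R * R)) := ~ P s.1 s.2.1 s.2.2 ->
  exists i j : 'I_3, [/\ ~ P t.1 t.2.1 t.2.2, t.1 = s.1.+1,
    t.2.1 = s.2.1 + i%:R / 3 ^+ t.1 & t.2.2 = s.2.2 + j%:R / 3 ^+ t.1].
have [F FS] : {F & forall s, step s (F s)}.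
  apply: choice => -[n [x y]]; rewrite /step /=.
  have [|nPn] := pselect (P n x y); first by exists (0%N, (0, 0)).
  have /existsNP[i /existsNP[j nPij]] := contra_not (@Psub n x y) nPn.
  by exists (n.+1, (x + i%:R / 3 ^+ n.+1, y + j%:R / 3 ^+ n.+1)) => _; exists i, j.
pose S n := iter n F (0%N, (0, 0)).
have SP n : ~ P (S n).1 (S n).2.1 (S n).2.2 /\ (S n).1 = n.
  elim: n => [//|n [IH1 IH2]] /=.
  by have [i [j [Pn e1 _ _]]] := FS _ IH1; split; rewrite // e1 IH2.
have SS n : exists i j : 'I_3, (S n.+1).2.1 = (S n).2.1 + i%:R / 3 ^+ n.+1 /\
    (S n.+1).2.2 = (S n).2.2 + j%:R / 3 ^+ n.+1.
  have [IH1 IH2] := SP n; have [i [j [_ e3 e1 e2]]] := FS _ IH1.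
  by exists i, j; rewrite /= e1 e2 e3 IH2.
have h0 n : 0 < (3 ^+ n : R)^-1 by rewrite invr_gt0 exprn_gt0.
have hS n : (3 ^+ n : R)^-1 = 3 * (3 ^+ n.+1)^-1.
  by rewrite exprS invfM mulrA divff ?mul1r // pnatr_eq0.
have i2 (i : 'I_3) : (i%:R : R) <= 2 by rewrite ler_nat -ltnS.
have key (u : nat -> R) : u 0%N = 0 ->
    (forall n, exists i : 'I_3, u n.+1 = u n + i%:R / 3 ^+ n.+1) ->
    exists2 p, 0 <= p <= 1 & forall n, u n <= p <= u n + (3 ^+ n)^-1.
  move=> u0 us; have [||n|p pP] := @nested_cells u (fun n => (3 ^+ n)^-1).
  - by move=> n; have [i ->] := us n; rewrite lerDl mulr_ge0 // ltW.
  - move=> n; have [i ->] := us n; rewrite (hS n).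
    by have := h0 n.+1; have := i2 i; nra.
  - exact: ltW.
  - by exists p => //; have := pP 0%N; rewrite u0 expr0 invr1 add0r.
have [||p p01 pP] := key (fun n => (S n).2.1); first by [].
  by move=> n; have [i [j []]] := SS n; exists i.
have [||q q01 qP] := key (fun n => (S n).2.2); first by [].
  by move=> n; have [i [j []]] := SS n; exists j.
have [d d0 dP] := Ploc _ _ p01 q01.
have [n nd] : exists n, (3 ^+ n : R)^-1 < d.
  have [n dn] := @expr_unbounded 3 d^-1 (ltr1n _ 3).
  by exists n; rewrite invf_plt ?posrE ?exprn_gt0.
have [nPn en] := SP n; apply: nPn; rewrite en.
exact: dP.
Qed.
End Cousin.

(** * Trapezoid sums along segments and squares *)
Section Contour.
Variable R : realType.
Implicit Types (f g : R[i] -> R[i]) (z d w l : R[i]).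

(** Complex differentiability, free of limits and
    with real tolerances; [differentiable_cderiv] relates it to
    [differentiable]. *)
Definition cderiv f w l := forall e : R, 0 < e -> exists2 r : R, 0 < r &
  forall z, normc (z - w) < r -> normc (f z - f w - l * (z - w)) <= e * normc (z - w).

(** The trapezoid approximation of the integral of [f] along the segment from
    [z] to [z + d], on [3 ^ m] pieces.  Defining it by recursion on the
    division in three, rather than as an indexed sum, makes additivity
    definitional and turns every estimate into an induction on [m]. *)
Fixpoint trapsum f m z d : R[i] := if m is n.+1 then
    trapsum f n z (d / 3) + trapsum f n (z + d / 3) (d / 3) +
    trapsum f n (z + 2 * (d / 3)) (d / 3)
  else (f z + f (z + d)) / 2 * d.

(** The boundary of the square with corners [z], [z + d], [z + d + 'i * d] and
    [z + 'i * d], followed counterclockwise. *)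
Definition loopsum f m z d := trapsum f m z d + trapsum f m (z + d) ('i * d)
  - trapsum f m (z + 'i * d) d - trapsum f m z ('i * d).

Lemma trapsumS f m z d : trapsum f m.+1 z d = trapsum f m z (d / 3) +
  trapsum f m (z + d / 3) (d / 3) + trapsum f m (z + 2 * (d / 3)) (d / 3).
Proof. by []. Qed.

Lemma trapsumD f g m z d :
  trapsum (fun w => f w + g w) m z d = trapsum f m z d + trapsum g m z d.
Proof.
elim: m z d => [|m IH] z d; first by rewrite /=; ring.
by rewrite !trapsumS !IH; ring.
Qed.

Lemma trapsumZ l f m z d : trapsum (fun w => l * f w) m z d = l * trapsum f m z d.
Proof.
elim: m z d => [|m IH] z d; first by rewrite /=; ring.
by rewrite !trapsumS !IH; ring.
Qed.

(** The trapezoid rule is exact on affine functions, so the closed sums of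
    [loopsum_affine] vanish. *)
Lemma trapsum_affine a b m z d :
  trapsum (fun w => a + b * w) m z d = (a + b * z) * d + b * d ^+ 2 / 2.
Proof.
elim: m z d => [|m IH] z d; first by rewrite /=; field.
by rewrite trapsumS !IH; field.
Qed.

Lemma thirds (Q : R -> Prop) :
  (forall t, 0 <= t <= 1 -> Q t) ->
  [/\ forall t, 0 <= t <= 1 -> Q (t / 3), forall t, 0 <= t <= 1 -> Q (1 / 3 + t / 3)
    & forall t, 0 <= t <= 1 -> Q (2 * (1 / 3) + t / 3)].
Proof. by move=> QP; split=> t /andP[t0 t1]; apply: QP; lra. Qed.

Lemma trapsum_ball f m z d (M : R) :
  (forall t : R, 0 <= t <= 1 -> normc (f (z + t%:C * d)) <= M) ->
  normc (trapsum f m z d) <= M * normc d.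
Proof.
elim: m z d => [|m IH] z d fM.
  rewrite /= normcM ler_wpM2r ?mod_ge0 // normcM normcV.
  rewrite mod_nat; have := fM 0; have := fM 1; rewrite rmorph0 rmorph1 mul0r mul1r addr0.
  have := modD (f z) (f (z + d)).
  by rewrite !lexx !ler01 => ? /(_ isT) ? /(_ isT) ?; lra.
have [f1 f2 f3] := thirds fM.
have d3 : normc (d / 3) = normc d / 3 by rewrite normcM normcV mod_nat.
rewrite trapsumS; apply: le_trans (modD _ _) _.
apply: le_trans (lerD (modD _ _) (lexx _)) _.
have e x (t : R) : z + (x + t / 3)%:C * d = z + x%:C * d + t%:C * (d / 3).
  by rewrite rmorphD rmorphM fmorphV rmorph_nat; field.
have h1 : normc (trapsum f m z (d / 3)) <= M * (normc d / 3).
  rewrite -d3; apply: IH => t /f1; rewrite -[X in X%:C * d]add0r e.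
  by rewrite rmorph0 mul0r addr0.
have h2 : normc (trapsum f m (z + d / 3) (d / 3)) <= M * (normc d / 3).
  rewrite -d3; apply: IH => t /f2; rewrite e rmorphM fmorphV rmorph_nat rmorph1.
  by rewrite mulrAC mul1r.
have h3 : normc (trapsum f m (z + 2 * (d / 3)) (d / 3)) <= M * (normc d / 3).
  rewrite -d3; apply: IH => t /f3; rewrite e !rmorphM fmorphV !rmorph_nat rmorph1.
  by rewrite -mulrA [1 / 3 * d]mulrAC mul1r.
by move: h1 h2 h3; lra.
Qed.

(** A lower bound on the integrand, in a fixed direction, is inherited by the
    sum; it serves to keep the sums of [1 / z] away from 0. *)
Lemma trapsum_Im_ge f m z d (k : R) :
  (forall t : R, 0 <= t <= 1 -> k <= Im (f (z + t%:C * d) * d)) ->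
  k <= Im (trapsum f m z d).
Proof.
have ImM (x : R) w : Im (x%:C * w) = x * Im w.
  by case: w => a b /=; rewrite mul0r addr0.
have c3 : (3 : R[i])^-1 = (3^-1 : R)%:C by rewrite fmorphV rmorph_nat.
elim: m z d k => [|m IH] z d k fM.
  have := fM 0; have := fM 1; rewrite rmorph0 rmorph1 mul0r mul1r addr0.
  rewrite !lexx !ler01 => /(_ isT) ? /(_ isT) ? /=.
  have -> : (f z + f (z + d)) / 2 * d = (2^-1)%:C * (f z * d + f (z + d) * d).
    by rewrite fmorphV rmorph_nat; field.
  by rewrite ImM raddfD /=; lra.
have [f1 f2 f3] := thirds fM.
have e x (t : R) : z + (x + t / 3)%:C * d = z + x%:C * d + t%:C * (d / 3).
  by rewrite rmorphD rmorphM fmorphV rmorph_nat; field.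
have e3 w : Im (w * (d / 3)) = Im (w * d) / 3.
  by rewrite c3 [w * _]mulrA [_ * _%:C]mulrC ImM mulrC.
have h1 : k / 3 <= Im (trapsum f m z (d / 3)).
  apply: IH => t /f1; rewrite -[X in X%:C * d]add0r e e3.
  by rewrite rmorph0 mul0r addr0; lra.
have h2 : k / 3 <= Im (trapsum f m (z + d / 3) (d / 3)).
  apply: IH => t /f2; rewrite e e3 rmorphM fmorphV rmorph_nat rmorph1.
  by rewrite mulrAC mul1r; lra.
have h3 : k / 3 <= Im (trapsum f m (z + 2 * (d / 3)) (d / 3)).
  apply: IH => t /f3; rewrite e e3 !rmorphM fmorphV !rmorph_nat rmorph1.
  by rewrite -mulrA [1 / 3 * d]mulrAC mul1r; lra.
by rewrite trapsumS !raddfD /=; lra.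
Qed.

(** The sides interior to the square are followed twice, in opposite
    directions, and cancel.  In the proof, [P a b] is the vertex with coordinates
    [(a, b)] in units of a third of the side. *)
Lemma loopsum_subdivide f m z d : loopsum f m.+1 z d =
  \sum_(i < 3) \sum_(j < 3) loopsum f m (z + (i%:R + 'i * j%:R) * (d / 3)) (d / 3).
Proof.
pose e := d / 3; have de : d = 3 * e by rewrite /e; field.
have ide : 'i * d / 3 = 'i * e by rewrite mulrA.
pose P (a b : nat) := z + (a%:R + 'i * b%:R) * e.
have Pe a b : P a b + e = P a.+1 b by rewrite /P -natr1; ring.
have Pi a b : P a b + 'i * e = P a b.+1 by rewrite /P -natr1; ring.
have Pee a b : P a b + 2 * e = P a.+2 b by rewrite -!Pe; ring.
have Pii a b : P a b + 2 * ('i * e) = P a b.+2 by rewrite -!Pi; ring.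
have zP : z = P 0%N 0%N by rewrite /P; ring.
have zdP : z + d = P 3 0%N by rewrite de /P; ring.
have zidP : z + 'i * d = P 0%N 3 by rewrite de /P; ring.
rewrite {1}/loopsum zdP zidP zP !trapsumS ide -/e !(Pe, Pi, Pee, Pii).
under eq_bigr do under eq_bigr do rewrite -zP -/e -/(P _ _) /loopsum !(Pe, Pi).
by rewrite !big_ord_recl !big_ord0 /= /bump /=; ring.
Qed.

Lemma loopsumD f g m z d :
  loopsum (fun w => f w + g w) m z d = loopsum f m z d + loopsum g m z d.
Proof. by rewrite /loopsum !trapsumD; ring. Qed.

Lemma loopsumZ l f m z d : loopsum (fun w => l * f w) m z d = l * loopsum f m z d.
Proof. by rewrite /loopsum !trapsumZ; ring. Qed.

Lemma loopsum_affine a b m z d : loopsum (fun w => a + b * w) m z d = 0.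
Proof. by rewrite /loopsum !trapsum_affine; field. Qed.

Lemma loopsum_ball f m z d (M : R) :
  (forall t : R, 0 <= t <= 1 ->
    [/\ normc (f (z + t%:C * d)) <= M, normc (f (z + (1 +i* t) * d)) <= M,
        normc (f (z + (t +i* 1) * d)) <= M & normc (f (z + (0 +i* t) * d)) <= M]) ->
  normc (loopsum f m z d) <= 4 * M * normc d.
Proof.
move=> fM; have nid : normc ('i * d) = normc d by rewrite normcM mod_i mul1r.
rewrite /loopsum; apply: le_trans (modB _ _) _.
apply: le_trans (lerD (modB _ _) (lexx _)) _.
apply: le_trans (lerD (lerD (modD _ _) (lexx _)) (lexx _)) _.
have h1 : normc (trapsum f m z d) <= M * normc d.
  by apply: trapsum_ball => t /fM[].
have h2 : normc (trapsum f m (z + d) ('i * d)) <= M * normc d.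
  rewrite -nid; apply: trapsum_ball => t /fM[_ + _ _].
  by rewrite [_ +i* _]cartesian /= -addrA mulrDl rmorph1 mul1r mulrA [t%:C * _]mulrC.
have h3 : normc (trapsum f m (z + 'i * d) d) <= M * normc d.
  apply: trapsum_ball => t /fM[_ _ + _].
  by rewrite [_ +i* _]cartesian /= -addrA mulrDl rmorph1 mulr1 [_%:C * d + _]addrC.
have h4 : normc (trapsum f m z ('i * d)) <= M * normc d.
  rewrite -nid; apply: trapsum_ball => t /fM[_ _ _].
  by rewrite [_ +i* _]cartesian /= add0r mulrA [t%:C * _]mulrC.
by move: h1 h2 h3 h4; lra.
Qed.
End Contour.

(** * Goursat's theorem *)
Section Goursat.
Variable R : realType.
Implicit Types (f g : R[i] -> R[i]) (z d w l : R[i]).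

Lemma loopsum_subdivide_near f z d (E : 'I_3 -> 'I_3 -> R) :
  (forall i j : 'I_3, \forall m \near \oo,
    normc (loopsum f m (z + (i%:R + 'i * j%:R) * (d / 3)) (d / 3)) <= E i j) ->
  \forall m \near \oo, normc (loopsum f m z d) <= \sum_i \sum_j E i j.
Proof.
move=> fE; apply: near_inftyS; near=> m; rewrite loopsum_subdivide.
apply: mod_sum => i; apply: mod_sum => j; move: i j; near: m.
by apply: filter_forall => i; apply: filter_forall => j; exact: fE.
Unshelve. all: by end_near. Qed.

(** On a cell of side [h] close to a point [c], [f] differs from its tangent
    at [c] by at most [k * h], up to a constant, so the sum along the boundary
    is at most [k * h ^ 2] since the tangent contributes nothing.  This bound
    is proportional to the area, hence stable under assembling nine cells, and
    Cousin's lemma extends it to the whole square. *)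
Lemma goursat f z d :
  (forall x y : R, 0 <= x <= 1 -> 0 <= y <= 1 ->
    exists l, cderiv f (z + (x +i* y) * d) l) ->
  forall e : R, 0 < e -> \forall m \near \oo, normc (loopsum f m z d) <= e.
Proof.
move=> df e e0; pose D := normc d; have D0 : 0 <= D by exact: mod_ge0.
(* the bound per unit of area; adding 1 covers the degenerate case [d = 0] *)
pose k := e / (D ^+ 2 + 1).
have D20 : 0 < D ^+ 2 + 1 by rewrite ltr_pwDr // sqr_ge0.
have k0 : 0 < k by rewrite divr_gt0.
pose P (n : nat) (x y : R) := \forall m \near \oo,
  normc (loopsum f m (z + (x +i* y) * d) (d * (3 ^+ n)^-1%:C)) <= k * (D / 3 ^+ n) ^+ 2.
suff : P 0%N 0 0.
  rewrite /P expr0 invr1 rmorph1 !mulr1 (_ : 0 +i* 0 = 0) // mul0r addr0.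
  apply: filterS => m /le_trans; apply.
  by rewrite /k mulrAC ler_pdivrMr // ler_wpM2l ?ltW // ltrDl.
apply: cousin => [n x y Pij|p q p01 q01].
  rewrite /P; have -> : k * (D / 3 ^+ n) ^+ 2 =
      \sum_(i < 3) \sum_(j < 3) (k * (D / 3 ^+ n.+1) ^+ 2).
    rewrite !sumr_const !card_ord (exprS (3 : R) n).
    by field; rewrite expf_neq0.
  have c3 : (3^-1 : R)%:C = (3 : R[i])^-1 by rewrite fmorphV rmorph_nat.
  have hS : d * (3 ^+ n)^-1%:C / 3 = d * (3 ^+ n.+1)^-1%:C.
    by rewrite exprSr invfM rmorphM /= c3 mulrA.
  apply: loopsum_subdivide_near => i j; rewrite hS.
  have := Pij i j; rewrite /P; congr (nbhs _ _).
  apply/funext => m; congr (normc (loopsum _ _ _ _) <= _).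
  rewrite [_ +i* (_ + _)]cartesian [x +i* y]cartesian /=.
  by rewrite !(rmorphD, rmorphM) !rmorph_nat /=; ring.
have [l fl] := df p q p01 q01.
have k8 : 0 < k / 8 by rewrite divr_gt0.
have [r r0 rP] := fl _ k8.
exists (r / (2 * D + 1)); first by rewrite divr_gt0 // ltr_pwDr // mulr_ge0.
move=> n x y; set h := (3 ^+ n)^-1 => hr xp yp.
have h0 : 0 < h by rewrite invr_gt0 exprn_gt0.
set c := z + (p +i* q) * d in rP.
have near_c s t : 0 <= s <= 1 -> 0 <= t <= 1 ->
    normc (z + (x +i* y) * d + (s +i* t) * (d * h%:C) - c) <= 2 * h * D.
  move=> s01 t01.
  have -> : z + (x +i* y) * d + (s +i* t) * (d * h%:C) - c =
     ((x + s * h - p) +i* (y + t * h - q)) * d.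
    rewrite /c [(s +i* t)]cartesian [_ +i* (_ - _)]cartesian [x +i* y]cartesian.
    by rewrite [p +i* q]cartesian /= !(rmorphD, rmorphN, rmorphM) /=; ring.
  rewrite normcM ler_wpM2r // (le_trans (mod_le_ReIm _)) //=.
  have : 0 <= s * h <= h by nra.
  have : 0 <= t * h <= h by nra.
  move=> ? ?; have : `|x + s * h - p| <= h by rewrite ler_norml; lra.
  have : `|y + t * h - q| <= h by rewrite ler_norml; lra.
  by lra.
have fb s t : 0 <= s <= 1 -> 0 <= t <= 1 ->
    normc (f (z + (x +i* y) * d + (s +i* t) * (d * h%:C)) +
      ((l * c - f c) + (- l) * (z + (x +i* y) * d + (s +i* t) * (d * h%:C))))
    <= k / 8 * (2 * h * D).
  move=> s01 t01; have := near_c s t s01 t01; set w := _ + _ * (d * _) => wc.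
  have -> : f w + (l * c - f c + - l * w) = f w - f c - l * (w - c) by ring.
  apply: le_trans (rP _ _) _; last by rewrite ler_wpM2l // ltW.
  apply: le_lt_trans wc _.
  by move: hr; rewrite ltr_pdivlMr; [nra|rewrite ltr_pwDr // mulr_ge0].
rewrite /P -/h; near=> m.
rewrite -[loopsum _ _ _ _]addr0 -(loopsum_affine (l * c - f c) (- l) m (z + (x +i* y) * d) (d * h%:C)) -loopsumD.
apply: (le_trans (loopsum_ball _ (M := k / 8 * (2 * h * D)) _)).
  move=> t t01; have o01 : 0 <= (1 : R) <= 1 by rewrite lexx ler01.
  have z01 : 0 <= (0 : R) <= 1 by rewrite lexx ler01.
  by split; exact: fb.
rewrite normcM mod_real gtr0_norm // -/D.
by rewrite le_eqVlt; apply/orP; left; apply/eqP; field.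
Unshelve. all: by end_near. Qed.

End Goursat.

(** * Differentiability by inequalities *)
Section Differentiable.
Variable R : realType.

Lemma gt0_real (e : Cplx R) : 0 < e -> exists2 x : R, 0 < x & e = x%:C.
Proof.
move=> e0; have /complex_realP[x ex] : (e : R[i]) \is Num.real by exact: gtr0_real.
by exists x => //; move: e0; rewrite ex ltcR.
Qed.

Lemma nbhs_modP (z : Cplx R) (A : set (Cplx R)) : nbhs z A <->
  exists2 r : R, 0 < r & forall w : R[i], normc (w - z) < r -> A w.
Proof.
split=> [/nbhs_ballP[_ /= /gt0_real[r r0 ->] rA]|[r r0 rA]].
  exists r => // w wz; apply: rA.
  by rewrite -ball_normE /= -opprB normrN norm_mod ltcR.
apply/nbhs_ballP; exists (r%:C : Cplx R) => /=; first by rewrite ltcR.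
by move=> w; rewrite -ball_normE /= -opprB normrN norm_mod ltcR => /rA.
Qed.

Lemma differentiable_cderiv (f : Cplx R -> Cplx R) (z : Cplx R) :
  differentiable f z <-> exists l, cderiv (f : R[i] -> R[i]) z l.
Proof.
split=> [/derivable1_diffP /cvg_ex[l /cvgrPdist_le fl]|[l fl]].
  exists l => e e0; have /fl : 0 < (e%:C : Cplx R) by rewrite ltcR.
  rewrite near_withinE => /nbhs_modP[r r0 rP]; exists r => // w wz.
  have [->|wz0] := eqVneq w z; first by rewrite !subrr mulr0 subrr normc0 mulr0.
  have h0 : w - z != 0 by rewrite subr_eq0.
  have /rP : normc (w - z - 0) < r by rewrite subr0.
  move=> /(_ h0) /=.
  rewrite /GRing.scale /= mulr1 subrK norm_mod lecR => H.
  have -> : f w - f z - l * (w - z) = - (l - (w - z)^-1 * (f w - f z)) * (w - z).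
    by field.
  by rewrite normcM modN ler_wpM2r // mod_ge0.
apply/derivable1_diffP/(@cvgP _ _ (l : Cplx R))/cvgrPdist_le => _ /gt0_real[e e0 ->].
have [r r0 rP] := fl _ e0.
rewrite near_withinE; apply/nbhs_modP; exists r => // h; rewrite subr0 => hr h0 /=.
rewrite /GRing.scale /= mulr1 norm_mod lecR.
have /rP : normc (h + z - z) < r by rewrite addrK.
rewrite addrK => H; have nh : 0 < normc h by exact: mod_gt0.
rewrite -(ler_pM2r nh) -normcM.
have -> : (l - h^-1 * (f (h + z) - f z)) * h = - (f (h + z) - f z - l * h) by field.
by rewrite modN.
Qed.
End Differentiable.

(** * Squares around an isolated singularity *)
Section Liouville.
Variable R : realType.
Implicit Types (f g : R[i] -> R[i]) (z w l : R[i]) (s e r : R).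

(** The lower left corner of the square centred at 0 whose side is [2 * s]. *)
Definition corner s : R[i] := - s%:C - 'i * s%:C.

Lemma square_point s (x y : R) :
  corner s + (x +i* y) * (2 * s)%:C = ((2 * x - 1) * s) +i* ((2 * y - 1) * s).
Proof.
rewrite /corner [x +i* y]cartesian [RHS]cartesian /=.
by rewrite !(rmorphM, rmorphB) /= rmorph_nat rmorph1; ring.
Qed.

Lemma square_side s (x y : R) : 0 < s -> 0 <= x <= 1 -> 0 <= y <= 1 ->
  [\/ x = 0, x = 1, y = 0 | y = 1] ->
  s <= normc (corner s + (x +i* y) * (2 * s)%:C) <= 2 * s.
Proof.
move=> s0 x01 y01 side; rewrite square_point; apply/andP; split; last first.
  apply: le_trans (mod_le_ReIm _) _ => /=.
  have : `|(2 * x - 1) * s| <= s by rewrite ler_norml; nra.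
  have : `|(2 * y - 1) * s| <= s by rewrite ler_norml; nra.
  by lra.
set z := Complex _ _; have := Re_le_mod z; have := Im_le_mod z.
rewrite /= !ler_norml.
by case: side => ->; lra.
Qed.

Lemma loopsum_square_ball g s m (M : R) : 0 < s ->
  (forall z, s <= normc z <= 2 * s -> normc (g z) <= M) ->
  normc (loopsum g m (corner s) (2 * s)%:C) <= 8 * M * s.
Proof.
move=> s0 gM; have o01 : 0 <= (1 : R) <= 1 by rewrite lexx ler01.
have z01 : 0 <= (0 : R) <= 1 by rewrite lexx ler01.
have -> : 8 * M * s = 4 * M * normc (2 * s)%:C.
  by rewrite mod_real gtr0_norm ?mulr_gt0 //; ring.
apply: loopsum_ball => t t01; split; apply: gM; apply: square_side => //.
- exact: Or43.
- exact: Or42.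
- exact: Or44.
- exact: Or41.
Qed.

(** If [g z * z] tends to 0 at 0, the small squares contribute little: their
    perimeter is [8 * s] while [g] is at most of order [e / s] on their
    boundary, for a given [e]. *)
Lemma punctured_loopsum_small g : (forall e, 0 < e -> exists2 r, 0 < r &
    forall z, z != 0 -> normc z < r -> normc (g z) * normc z <= e) ->
  forall e, 0 < e -> exists2 r, 0 < r & forall s m, 0 < s < r ->
    normc (loopsum g m (corner s) (2 * s)%:C) <= e.
Proof.
move=> g0 e e0; have e8 : 0 < e / 8 by rewrite divr_gt0.
have [r r0 rP] := g0 _ e8.
exists (r / 2); first by rewrite divr_gt0.
move=> s m /andP[s0 sr]; have -> : e = 8 * (e / 8 / s) * s by field; rewrite gt_eqF.
apply: loopsum_square_ball => // z /andP[sz zs]; rewrite ler_pdivlMr //.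
have z0 : z != 0 by apply: contraTneq sz => ->; rewrite normc0 -ltNge.
have /(rP _ z0) : normc z < r by lra.
by apply: le_trans; rewrite ler_wpM2l ?mod_ge0.
Qed.

(** Dividing a centred square in nine leaves the singularity in the interior
    of the central part, again a centred square; the eight others fall under
    Goursat's theorem.  Iterating brings the sum back to that of an
    arbitrarily small centred square. *)
Lemma punctured_loopsum g : (forall z, z != 0 -> exists l, cderiv g z l) ->
  (forall e, 0 < e -> exists2 r, 0 < r &
    forall z, z != 0 -> normc z < r -> normc (g z) * normc z <= e) ->
  forall s e, 0 < s -> 0 < e ->
    \forall m \near \oo, normc (loopsum g m (corner s) (2 * s)%:C) <= e.
Proof.
move=> dg g0.
have step s e e' : 0 < s -> 0 < e' ->
    (\forall m \near \oo, normc (loopsum g m (corner (s / 3)) (2 * (s / 3))%:C) <= e) ->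
    \forall m \near \oo, normc (loopsum g m (corner s) (2 * s)%:C) <= e + e'.
  move=> s0 e'0 He.
  (* [(1, 1)] is the central cell *)
  pose E (i j : 'I_3) := if (i == 1 :> nat) && (j == 1 :> nat) then e else e' / 8.
  have -> : e + e' = \sum_i \sum_j E i j.
    by rewrite !big_ord_recl !big_ord0 /E /=; field.
  have c3 : (2 * s)%:C / 3 = (2 * (s / 3))%:C :> R[i].
    by rewrite !rmorphM /= fmorphV !rmorph_nat; field.
  apply: loopsum_subdivide_near => i j; rewrite c3 /E.
  have ij_real : i%:R + 'i * j%:R = (i%:R : R) +i* (j%:R : R).
    by rewrite [RHS]cartesian /= !rmorph_nat.
  have corner3 : corner s = corner (s / 3) - (1 + 'i) * (2 * (s / 3))%:C.
    by rewrite /corner !rmorphM /= fmorphV !rmorph_nat; field.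
  case: ifPn => [/andP[/eqP-> /eqP->]|ij].
    by rewrite mulr1 corner3 subrK.
  apply: goursat => [x y x01 y01|]; last by rewrite divr_gt0.
  apply: dg; rewrite ij_real -addrA -mulrDl.
  have -> : (2 * (s / 3))%:C = (3^-1)%:C * (2 * s)%:C :> R[i].
    by rewrite -rmorphM /=; congr (_%:C); field.
  rewrite mulrA.
  have -> : ((i%:R : R) +i* (j%:R : R) + x +i* y) * (3^-1)%:C =
            ((i%:R + x) / 3) +i* ((j%:R + y) / 3).
    by rewrite [i%:R +i* _]cartesian [x +i* y]cartesian [RHS]cartesian /= !(rmorphM, rmorphD) /=; ring.
  rewrite square_point eq_complex /= !mulf_eq0 (gt_eqF s0) !orbF negb_and.
  move: ij; rewrite negb_and => /orP[]; [move=> H; apply/orP; left|move=> H; apply/orP; right].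
    move: H; case: i {ij_real} => -[|[|[|//]]] ? //= _; rewrite ?mulr0n ?mulr1n; apply/eqP; lra.
  move: H; case: j {ij_real} => -[|[|[|//]]] ? //= _; rewrite ?mulr0n ?mulr1n; apply/eqP; lra.
have iterate n : forall s e e', 0 < s -> 0 < e' ->
    (\forall m \near \oo,
      normc (loopsum g m (corner (s / 3 ^+ n)) (2 * (s / 3 ^+ n))%:C) <= e) ->
    \forall m \near \oo, normc (loopsum g m (corner s) (2 * s)%:C) <= e + e'.
  elim: n => [|n IH] s e e' s0 e'0 He.
    rewrite expr0 divr1 in He; apply: filterS He => m /le_trans; apply.
    by rewrite lerDl ltW.
  have -> : e + e' = e + e' / 2 + e' / 2 by lra.
  apply: step => //; first by rewrite divr_gt0.
  apply: IH; rewrite ?divr_gt0 //.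
  suff <- : s / 3 ^+ n.+1 = s / 3 / 3 ^+ n by [].
  by rewrite exprS invfM mulrA.
move=> s e s0 e0; have e2 : 0 < e / 2 by rewrite divr_gt0.
have [r r0 rP] := punctured_loopsum_small g0 e2.
have [n rn] := @expr_unbounded R 3 (s / r) (ltr1n _ 3).
have -> : e = e / 2 + e / 2 by lra.
apply: (iterate n) => //; near=> m; apply: rP.
have n0 : 0 < 3 ^+ n :> R by rewrite exprn_gt0.
rewrite divr_gt0 //= ltr_pdivrMr // mulrC -ltr_pdivrMr //.
Unshelve. all: by end_near. Qed.

(** The integral is [2 pi i]; the bound 4 comes from a contribution of at
    least 1 to the imaginary part on each side, where the integrand
    is [2 * s ^ 2 / (x ^ 2 + s ^ 2)] once scaled by the length of the side. *)
Lemma loopsum_inv s m : 0 < s ->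
  4 <= normc (loopsum (fun z => z^-1) m (corner s) (2 * s)%:C).
Proof.
move=> s0; apply: le_trans (Im_le_mod _).
apply: le_trans (ler_norm _).
have sq (t : R) : 0 <= t <= 1 -> 0 < ((2 * t - 1) * s) ^+ 2 + s ^+ 2 <= 2 * s * s.
  move=> t01; have u1 : `|2 * t - 1| <= 1 by rewrite ler_norml; lra.
  rewrite ltr_wpDl ?sqr_ge0 ?exprn_gt0 //= exprMn.
  have : (2 * t - 1) ^+ 2 <= 1 by rewrite -[leLHS]real_normK ?num_real // expr_le1.
  by have := sqr_ge0 s; rewrite !expr2; nra.
have quot (t : R) : 0 <= t <= 1 -> 1 <= 2 * s * s / (((2 * t - 1) * s) ^+ 2 + s ^+ 2).
  by move=> /sq /andP[? ?]; rewrite ler_pdivlMr ?mul1r.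
pose D : R[i] := (2 * s)%:C.
have pt1 (t : R) : corner s + t%:C * D = ((2 * t - 1) * s) +i* (- s).
  by rewrite -[t%:C]/(t +i* 0) square_point; congr Complex; ring.
have pt2 (t : R) : corner s + D + t%:C * ('i * D) = s +i* ((2 * t - 1) * s).
  have -> : corner s + D + t%:C * ('i * D) = corner s + (1 +i* t) * D.
    by rewrite [1 +i* t]cartesian /= rmorph1; ring.
  by rewrite square_point; congr Complex; ring.
have pt3 (t : R) : corner s + 'i * D + t%:C * D = ((2 * t - 1) * s) +i* s.
  have -> : corner s + 'i * D + t%:C * D = corner s + (t +i* 1) * D.
    by rewrite [t +i* 1]cartesian /= rmorph1; ring.
  by rewrite square_point; congr Complex; ring.
have pt4 (t : R) : corner s + t%:C * ('i * D) = (- s) +i* ((2 * t - 1) * s).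
  have -> : corner s + t%:C * ('i * D) = corner s + (0 +i* t) * D.
    by rewrite [0 +i* t]cartesian /= rmorph0; ring.
  by rewrite square_point; congr Complex; ring.
have trapsumN f z d : - trapsum f m z d = trapsum (fun w => - 1 * f w) m z d.
  by rewrite trapsumZ mulN1r.
have iDE : 'i * D = 0 +i* (2 * s) by rewrite [RHS]cartesian /= rmorph0 add0r.
rewrite /loopsum -/D !trapsumN !raddfD /=.
have side1 : 1 <= Im (trapsum (fun z => z^-1) m (corner s) D).
  apply: trapsum_Im_ge => t t01; rewrite pt1 /=.
  by have := quot t t01; rewrite sqrrN; lra.
have side2 : 1 <= Im (trapsum (fun z => z^-1) m (corner s + D) ('i * D)).
  apply: trapsum_Im_ge => t t01; rewrite pt2 iDE /=.
  by have := quot t t01; rewrite [s ^+ 2 + _]addrC; lra.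
have side3 : 1 <= Im (trapsum (fun z => - 1 * z^-1) m (corner s + 'i * D) D).
  apply: trapsum_Im_ge => t t01; rewrite pt3 /=.
  by have := quot t t01; lra.
have side4 : 1 <= Im (trapsum (fun z => - 1 * z^-1) m (corner s) ('i * D)).
  apply: trapsum_Im_ge => t t01; rewrite pt4 iDE /=.
  by have := quot t t01; rewrite sqrrN [s ^+ 2 + _]addrC; lra.
by lra.
Qed.

End Liouville.

(** * Liouville's theorem *)
Section LiouvilleTheorem.
Variable R : realType.
Implicit Types (f : R[i] -> R[i]) (z w l : R[i]).

(** The sums of [g z = h z - l / z], where [h z = (f z - f 0) / z ^ 2], are
    negligible on every square around 0 and those of [h] are of order [M / s]
    on the square of side [2 * s].  The term [l / z] contributes at least
    [4 * normc l], a contradiction for large [s] unless [l = 0]. *)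
Lemma bounded_entire_cderiv_at0 f (M : R) :
  (forall z, exists l, cderiv f z l) -> (forall z, normc (f z) <= M) ->
  forall l, cderiv f 0 l -> l = 0.
Proof.
move=> df fM l fl; apply: contrapT => /eqP l0; have nl := mod_gt0 l0.
have M0 : 0 <= M by exact: le_trans (mod_ge0 _) (fM 0).
pose h z := (f z - f 0) * z^-1 ^+ 2.
pose g z := h z + (- l) * z^-1.
have dg (z : Cplx R) : z != 0 -> exists l, cderiv g z l.
  move=> z0; apply/differentiable_cderiv; have fz := (differentiable_cderiv f z).2 (df z).
  have dV : differentiable (fun w : Cplx R => w^-1) z by exact: differentiable_Rinv.
  apply: (@differentiableD _ _ _ (h : Cplx R -> Cplx R) (fun w : Cplx R => (- l : Cplx R) * w^-1)).
    apply: (@differentiableM _ _ (fun w : Cplx R => f w - f 0 : Cplx R) (fun w : Cplx R => w^-1 ^+ 2)).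
      exact: (@differentiableB _ _ _ (f : Cplx R -> Cplx R) (cst (f 0))).
    exact: (@differentiableX _ _ (fun w : Cplx R => w^-1) 1).
  exact: (@differentiableM _ _ (cst (- l : Cplx R)) (fun w : Cplx R => w^-1)).
have small e : 0 < e -> exists2 r : R, 0 < r &
    forall z, z != 0 -> normc z < r -> normc (g z) * normc z <= e.
  move=> e0; have [r r0 rP] := fl _ e0; exists r => // z z0 zr.
  have /rP : normc (z - 0) < r by rewrite subr0.
  have nz := mod_gt0 z0; rewrite subr0 => H.
  rewrite -normcM -(ler_pM2r nz) -normcM.
  suff -> : g z * z * z = f z - f 0 - l * z by [].
  by rewrite /g /h; field.
(* makes [16 * M / s], the bound for the sums of [h], less than [normc l] *)
pose s := 16 * (M + 1) / normc l.
have s0 : 0 < s by rewrite divr_gt0 // mulr_gt0 // ltr_wpDl.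
have [m _ /(_ m (leqnn m)) /= gm] := punctured_loopsum dg small s0 nl.
have hm : normc (loopsum h m (corner s) (2 * s)%:C) <= 16 * M / s.
  have -> : 16 * M / s = 8 * (2 * M / s ^+ 2) * s by field; rewrite gt_eqF.
  apply: loopsum_square_ball => // z /andP[sz _].
  rewrite /h normcM modX normcV; apply: ler_pM; rewrite ?mod_ge0 ?exprn_ge0 ?invr_ge0 ?mod_ge0 //.
    by apply: le_trans (modB _ _) _; have := fM 0; have := fM z; lra.
  rewrite exprVn lef_pV2 ?posrE ?exprn_gt0 //; last exact: lt_le_trans sz.
  by rewrite ler_pXn2r // nnegrE ?mod_ge0 ?ltW.
have M1 : 0 < M + 1 by rewrite ltr_wpDl.
have inv4 := loopsum_inv m s0.
have gE : loopsum g m (corner s) (2 * s)%:C = loopsum h m (corner s) (2 * s)%:C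
    - l * loopsum (fun z => z^-1) m (corner s) (2 * s)%:C.
  by rewrite /g loopsumD loopsumZ mulNr.
have : normc (l * loopsum (fun z => z^-1) m (corner s) (2 * s)%:C) <= normc l + 16 * M / s.
  have -> : l * loopsum (fun z => z^-1) m (corner s) (2 * s)%:C =
    loopsum h m (corner s) (2 * s)%:C - loopsum g m (corner s) (2 * s)%:C.
    by rewrite gE opprB addrC subrK.
  by apply: le_trans (modB _ _) _; rewrite [leRHS]addrC; exact: (lerD hm gm).
have -> : 16 * M / s = normc l * (M / (M + 1)).
  rewrite /s; field.
  by rewrite !gt_eqF.
have : M / (M + 1) <= 1 by rewrite ler_pdivrMr ?ltr_wpDl // mul1r lerDl.
rewrite normcM; move: (M / _) => q q1.
by move: inv4; set n := normc (loopsum _ _ _ _) => n4; nra.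
Qed.

(** By Cousin's lemma along the segment from [a] to [b], the increment of [f]
    on a piece is at most [e] times the share of the segment that it covers. *)
Lemma cderiv0_constant f : (forall z, cderiv f z 0) -> forall a b, f a = f b.
Proof.
move=> f0 a b; pose d := b - a.
suff fe : forall e : R, 0 < e -> normc (f b - f a) <= e.
  apply/esym/eqP; rewrite -subr_eq0; apply/eqP/eq0_normc/le_anti.
  by rewrite mod_ge0 andbT; apply/ler_addgt0Pl => e /fe; rewrite addr0.
move=> e e0.
pose F (t : R) := f (a + t%:C * d).
pose P n (x y : R) := normc (F (x + (3 ^+ n)^-1) - F x) <= e / 3 ^+ n.
suff : P 0%N 0 0.
  rewrite /P /F expr0 invr1 mulr1 add0r rmorph1 rmorph0 mul1r mul0r addr0.
  by rewrite /d [a + _]addrC subrK.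
apply: (@cousin _ P) => [n x y Pij|p q _ _].
  have hS : (3 ^+ n : R)^-1 = 3 / 3 ^+ n.+1.
    by rewrite exprS invfM mulrA divff ?mul1r // pnatr_eq0.
  have := Pij 0 0; have := Pij 1 0; have := Pij (inord 2) 0.
  rewrite /P /= inordK // mul0r addr0 mul1r hS; set h := (3 ^+ _)^-1.
  have -> : x + 2 * h + h = x + 3 * h by ring.
  have -> : x + h + h = x + 2 * h by ring.
  move=> h3 h2 h1.
  have -> : F (x + 3 * h) - F x = (F (x + 3 * h) - F (x + 2 * h)) +
     ((F (x + 2 * h) - F (x + h)) + (F (x + h) - F x)) by ring.
  apply: le_trans (modD _ _) _; have := modD (F (x + 2 * h) - F (x + h)) (F (x + h) - F x).
  by lra.
pose D := normc d; have D0 : 0 <= D by exact: mod_ge0.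
have D1 : 0 < D + 1 by rewrite ltr_wpDl.
have k0 : 0 < e / 2 / (D + 1) by rewrite !divr_gt0.
have [r r0 rP] := f0 (a + p%:C * d) _ k0.
exists (r / (D + 1)); first by rewrite divr_gt0.
move=> n x y; rewrite /P; set h := (3 ^+ n)^-1 => hr xp _.
have h0 : 0 < h by rewrite invr_gt0 exprn_gt0.
have near_p t : x <= t <= x + h -> normc (F t - F p) <= e / 2 * h.
  move=> tx; have tp : normc (a + t%:C * d - (a + p%:C * d)) <= h * D.
    have -> : a + t%:C * d - (a + p%:C * d) = (t - p)%:C * d by rewrite rmorphB; ring.
    by rewrite normcM mod_real ler_wpM2r // ler_norml; lra.
  have /rP : normc (a + t%:C * d - (a + p%:C * d)) < r.
    by apply: le_lt_trans tp _; move: hr; rewrite ltr_pdivlMr //; nra.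
  rewrite mul0r subr0 -/(F t) -/(F p) => /le_trans; apply.
  apply: (@le_trans _ _ (e / 2 / (D + 1) * (h * D))); first by rewrite ler_wpM2l // ltW.
  rewrite mulrAC ler_pdivrMr // -[leRHS]mulrA ler_wpM2l ?divr_ge0 ?(ltW e0) //.
  by rewrite ler_wpM2l ?(ltW h0) // lerDl.
have /near_p H1 : x <= x <= x + h by lra.
have /near_p H2 : x <= x + h <= x + h by lra.
have -> : F (x + h) - F x = (F (x + h) - F p) - (F x - F p) by ring.
by apply: le_trans (modB _ _) _; lra.
Qed.

Theorem liouville f (M : R) : (forall z, exists l, cderiv f z l) ->
  (forall z, normc (f z) <= M) -> forall a b, f a = f b.
Proof.
move=> df fM; apply: cderiv0_constant => a; have [l fl] := df a.
suff <- : l = 0 by [].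
apply: (@bounded_entire_cderiv_at0 (fun z => f (z + a)) M) => // [z|e e0].
  have [k fk] := df (z + a); exists k => e /fk[r r0 rP]; exists r => // w wz.
  have -> : w - z = w + a - (z + a) by ring.
  by apply: rP; have -> : w + a - (z + a) = w - z by ring.
have [r r0 rP] := fl e e0; exists r => // w wz; rewrite add0r.
have -> : w - 0 = w + a - a by ring.
by apply: rP; rewrite addrK; move: wz; rewrite subr0.
Qed.

End LiouvilleTheorem.

(** * Power series with nonnegative coefficients on the unit disc *)
Section PowerSeries.
Variable R : realType.
Implicit Types (u : nat -> R[i]) (v : nat -> R) (z w l : R[i]).

Definition dominated u v := (forall k, normc (u k) <= v k) /\ cvgn (series v).

(** The sum of a complex series, through the real and imaginary parts so as to
    rest on the completeness of [R]; it is meaningful on dominated series. *)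
Definition csum u : R[i] :=
  limn (series (fun k => Re (u k))) +i* limn (series (fun k => Im (u k))).

Lemma abs_le_cvg_series (x : nat -> R) v :
  (forall k, `|x k| <= v k) -> cvgn (series v) ->
  cvgn (series x) /\ `|limn (series x)| <= limn (series v).
Proof.
move=> xv cv; have cn : cvgn [normed series x].
  apply: series_le_cvg cv => k; rewrite ?xv ?normr_ge0 //.
  exact: le_trans (xv k).
split; first exact: (@normed_cvg R R^o).
apply: (le_trans (@lim_series_norm R R^o _ cn)).
exact: lim_series_le.
Qed.

Lemma dominated_cvg u v : dominated u v ->
  cvgn (series (fun k => Re (u k))) /\ cvgn (series (fun k => Im (u k))).
Proof.
move=> [uv cv]; split.
  by apply: (abs_le_cvg_series _ cv).1 => k; exact: le_trans (Re_le_mod _) _.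
by apply: (abs_le_cvg_series _ cv).1 => k; exact: le_trans (Im_le_mod _) _.
Qed.

(** The factor 2 comes from bounding the real and imaginary parts
    separately. *)
Lemma csum_le u v : dominated u v -> normc (csum u) <= 2 * limn (series v).
Proof.
move=> [uv cv]; apply: le_trans (mod_le_ReIm _) _ => /=.
have /abs_le_cvg_series/(_ cv)[_ h1] : forall k, `|Re (u k)| <= v k.
  by move=> k; exact: le_trans (Re_le_mod _) _.
have /abs_le_cvg_series/(_ cv)[_ h2] : forall k, `|Im (u k)| <= v k.
  by move=> k; exact: le_trans (Im_le_mod _) _.
by lra.
Qed.

Lemma csumD u u' v v' : dominated u v -> dominated u' v' ->
  csum (fun k => u k + u' k) = csum u + csum u'.
Proof.
move=> /dominated_cvg[c1 c2] /dominated_cvg[c3 c4].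
rewrite /csum; apply/eqP; rewrite eq_complex /=; apply/andP; split; apply/eqP.
  rewrite -(lim_seriesD c1 c3); congr (limn (series _)).
  by apply/funext => k; rewrite raddfD.
rewrite -(lim_seriesD c2 c4); congr (limn (series _)).
by apply/funext => k; rewrite raddfD.
Qed.

Lemma csumZ l u v : dominated u v -> csum (fun k => l * u k) = l * csum u.
Proof.
move=> /dominated_cvg[c1 c2]; case: l => a b.
rewrite /csum; apply/eqP; rewrite eq_complex /=; apply/andP; split; apply/eqP.
  rewrite -[a * _](lim_seriesZ (V := R^o) a c1) -[b * _](lim_seriesZ (V := R^o) b c2).
  rewrite -lim_seriesB; [|exact: is_cvg_seriesZ..].
  congr (limn (series _)); apply/funext => k.
  by rewrite -[RHS]/(a * Re (u k) - b * Im (u k)); case: (u k).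
rewrite -[a * _](lim_seriesZ (V := R^o) a c2) -[b * _](lim_seriesZ (V := R^o) b c1).
rewrite -lim_seriesD; [|exact: is_cvg_seriesZ..].
congr (limn (series _)); apply/funext => k.
by rewrite -[RHS]/(a * Im (u k) + b * Re (u k)); case: (u k).
Qed.

Lemma dominatedD u u' v v' : dominated u v -> dominated u' v' ->
  dominated (fun k => u k + u' k) (v + v').
Proof.
move=> [uv cv] [uv' cv']; split=> [k|]; last exact: is_cvg_seriesD.
exact: le_trans (modD _ _) (lerD _ _).
Qed.

Lemma dominatedZ l u v : dominated u v ->
  dominated (fun k => l * u k) (normc l *: (v : nat -> R^o)).
Proof.
move=> [uv cv]; split=> [k|]; last exact: is_cvg_seriesZ.
by rewrite normcM ler_wpM2l // mod_ge0.
Qed.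

(** Up to a constant depending on [r] and [t], the derivative of [z ^ m] on
    the disc of radius [r] is bounded by the value [t ^ m] at a larger
    radius; the next lemma says the same of the second-order remainder.  Thus
    the convergence of the series at [t] controls the termwise derivative. *)
Lemma exp_deriv_bound (r t : R) m : 0 <= r < t ->
  m%:R * r ^+ m.-1 * (t - r) <= t ^+ m.
Proof.
move=> /andP[r0 rt]; have t0 : 0 <= t by rewrite ltW // (le_lt_trans r0).
elim: m => [|m IH]; first by rewrite !mul0r expr0.
have rm : r ^+ m <= t ^+ m by apply: lerXn2r; rewrite ?nnegrE // ltW.
have -> : m.+1%:R * r ^+ m.+1.-1 * (t - r) =
    r * (m%:R * r ^+ m.-1 * (t - r)) + r ^+ m * (t - r).
  case: m {IH rm} => [|m]; first by rewrite /= expr0; ring.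
  by rewrite /= -[m.+2%:R]natr1 exprS; ring.
have -> : t ^+ m.+1 = r * t ^+ m + t ^+ m * (t - r) by rewrite exprS; ring.
by rewrite lerD ?ler_wpM2l ?ler_wpM2r // subr_ge0 ltW.
Qed.

Lemma exp_remainder_bound (r t : R) z w m : 0 <= r < t ->
  normc z <= r -> normc w <= r ->
  normc (w ^+ m - z ^+ m - m%:R * z ^+ m.-1 * (w - z)) * (t - r) ^+ 2
    <= t ^+ m * normc (w - z) ^+ 2.
Proof.
move=> /[dup] rt0 /andP[r0 rt] zr wr; set d := normc (w - z).
have t0 : 0 <= t by rewrite ltW // (le_lt_trans r0).
have q0 : 0 <= t - r by rewrite subr_ge0 ltW.
elim: m => [|m IH].
  rewrite /= !expr0 !mul0r subrr subr0 normc0 mul0r mul1r; exact: sqr_ge0.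
have -> : w ^+ m.+1 - z ^+ m.+1 - m.+1%:R * z ^+ m.+1.-1 * (w - z) =
  w * (w ^+ m - z ^+ m - m%:R * z ^+ m.-1 * (w - z)) + m%:R * z ^+ m.-1 * (w - z) ^+ 2.
  case: m {IH} => [|m]; first by rewrite /= !exprS !expr0; ring.
  by rewrite /= -[m.+2%:R]natr1 !exprS; ring.
have h1 : normc (w * (w ^+ m - z ^+ m - m%:R * z ^+ m.-1 * (w - z))) * (t - r) ^+ 2
    <= r * (t ^+ m * d ^+ 2).
  by rewrite normcM -mulrA ler_pM // ?mod_ge0 // mulr_ge0 ?mod_ge0 ?sqr_ge0.
have h2 : normc (m%:R * z ^+ m.-1 * (w - z) ^+ 2) * (t - r) ^+ 2
    <= (t - r) * (t ^+ m * d ^+ 2).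
  have := exp_deriv_bound m rt0; rewrite !normcM !modX mod_nat -/d => H.
  have : m%:R * normc z ^+ m.-1 * (t - r) <= t ^+ m.
    apply: le_trans H; rewrite ler_wpM2r // ler_wpM2l //.
    by apply: lerXn2r; rewrite ?nnegrE ?mod_ge0.
  move: (m%:R * _) (t ^+ m) => c T cT.
  have : 0 <= (T - c * (t - r)) * (d ^+ 2 * (t - r)).
    by rewrite mulr_ge0 ?subr_ge0 // mulr_ge0 ?sqr_ge0.
  by lra.
apply: le_trans (_ : _ <= (normc (w * (w ^+ m - z ^+ m - m%:R * z ^+ m.-1 * (w - z)))
  + normc (m%:R * z ^+ m.-1 * (w - z) ^+ 2)) * (t - r) ^+ 2) _.
  by rewrite ler_wpM2r ?sqr_ge0 // modD.
rewrite mulrDl; by apply: le_trans (lerD h1 h2) _; rewrite (exprS t m); lra.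
Qed.

Variables (a : nat -> R) (m : nat -> nat).
Hypothesis a0 : forall k, 0 <= a k.
Hypothesis a_cvg : forall t, 0 < t < 1 -> cvgn (series (fun k => a k * t ^+ m k)).

Definition power_series z := csum (fun k => (a k)%:C * z ^+ m k).

Lemma normc_a k : normc (a k)%:C = a k.
Proof. by rewrite mod_real ger0_norm. Qed.

Lemma power_series_cderiv z : normc z < 1 -> exists l, cderiv power_series z l.
Proof.
move=> z1; have z0 := mod_ge0 z.
pose r := (normc z + 1) / 2; pose t := (r + 1) / 2.
have zr : normc z < r by rewrite /r; lra.
have r1 : r < 1 by rewrite /r; lra.
have rt : 0 <= r < t by rewrite /t; lra.
have t01 : 0 < t < 1 by move: rt; rewrite /t; lra.
have q0 : 0 < t - r by lra.
pose T k := a k * t ^+ m k; have cT : cvgn (series T) by exact: a_cvg.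
have domT w : normc w <= r -> dominated (fun k => (a k)%:C * w ^+ m k) T.
  move=> wr; split=> // k; rewrite normcM normc_a ler_wpM2l // modX.
  by apply: lerXn2r; rewrite ?nnegrE ?mod_ge0 //; lra.
pose D k := (a k)%:C * ((m k)%:R * z ^+ (m k).-1).
have domD : dominated D (fun k => (t - r)^-1 *: (T k : R^o)).
  split=> [k|]; last exact: is_cvg_seriesZ.
  rewrite /D normcM normc_a /GRing.scale /= mulrCA ler_wpM2l // [leRHS]mulrC.
  rewrite ler_pdivlMr // normcM mod_nat modX.
  apply: le_trans (exp_deriv_bound (m k) rt); rewrite ler_wpM2r ?(ltW q0) //.
  by rewrite ler_wpM2l //; apply: lerXn2r; rewrite ?nnegrE ?mod_ge0 //; lra.
pose V := limn (series T).
have V0 : 0 <= V.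
  have := csum_le (domT z (ltW zr)); have := mod_ge0 (csum (fun k => (a k)%:C * z ^+ m k)).
  by rewrite -/V; lra.
exists (csum D) => e e0.
have W0 : 0 < 2 * V + 1 by lra.
have q20 : 0 < (t - r) ^+ 2 by rewrite exprn_gt0.
exists (Num.min (r - normc z) (e * (t - r) ^+ 2 / (2 * V + 1))).
  by rewrite lt_min subr_gt0 zr divr_gt0 // mulr_gt0.
move=> w; rewrite lt_min ltr_pdivlMr // => /andP[wz1 wz2].
have wr : normc w <= r.
  have -> : w = (w - z) + z by rewrite subrK.
  by apply: le_trans (modD _ _) _; lra.
set d := normc (w - z) in wz1 wz2 *.
pose E k := (a k)%:C * (w ^+ m k - z ^+ m k - (m k)%:R * z ^+ (m k).-1 * (w - z)).
have domE : dominated E (fun k => (d ^+ 2 / (t - r) ^+ 2) *: (T k : R^o)).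
  split=> [k|]; last exact: is_cvg_seriesZ.
  rewrite /E normcM normc_a /GRing.scale /= mulrCA ler_wpM2l //.
  rewrite [leRHS]mulrAC ler_pdivlMr // [leRHS]mulrC.
  exact: exp_remainder_bound rt (ltW zr) wr.
have -> : power_series w - power_series z - csum D * (w - z) = csum E.
  have domz := domT z (ltW zr).
  rewrite -mulN1r -(csumZ (-1) domz) [csum D * _]mulrC -mulNr -(csumZ _ domD).
  rewrite -(csumD (domT w wr) (dominatedZ (-1) domz)).
  rewrite -(csumD (dominatedD (domT w wr) (dominatedZ (-1) domz)) (dominatedZ _ domD)).
  by congr csum; apply/funext => k; rewrite /E /D; ring.
apply: le_trans (csum_le domE) _; rewrite lim_seriesZ // /GRing.scale /= -/V.
rewrite mulrA [2 * _]mulrA mulrAC ler_pdivrMr //.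
have d0 : 0 <= d by exact: mod_ge0.
by nra.
Qed.
End PowerSeries.

(** * A holomorphic function of prescribed growth along a sequence *)
Section Interpolation.
Variable R : realType.

Definition radius k : R := 1 - k.+2%:R^-1.

Lemma radius_gt0 k : 0 < radius k.
Proof. by rewrite subr_gt0 invf_lt1 ?ltr1n. Qed.

Lemma radius_lt1 k : radius k < 1.
Proof. by rewrite gtrBl invr_gt0. Qed.

Lemma ltr_radius : {mono radius : j k / (j < k)%N >-> j < k}.
Proof. by move=> j k; rewrite ltrD2l ltrN2 ltf_pV2 ?posrE // ltr_nat. Qed.

Lemma radius_exhaust t : t < 1 -> exists K, t <= radius K.
Proof.
move=> t1; have d0 : 0 < 1 - t by rewrite subr_gt0.
exists (Num.bound (1 - t)^-1); rewrite lerBrDl -lerBrDr.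
rewrite invf_ple ?posrE //; apply: le_trans (ltW (unstable.ltr_bound _)) _.
by rewrite ler_nat ltnW.
Qed.

(** Scale the monomial so that its value at [x] is [eps]; its value at [y] is
    then [eps * (y / x) ^ m], which is unbounded in [m]. *)
Lemma monomial_gap (x y eps B : R) : 0 < x < y -> 0 < eps ->
  exists cm : R * nat, [/\ 0 <= cm.1, cm.1 * x ^+ cm.2 <= eps & B <= cm.1 * y ^+ cm.2].
Proof.
move=> /andP[x0 xy] eps0; have q1 : 1 < y / x by rewrite ltr_pdivlMr ?mul1r.
have [m Bm] := expr_unbounded (B / eps) q1.
have xm : 0 < x ^+ m by rewrite exprn_gt0.
exists (eps / x ^+ m, m) => /=; split; first by rewrite divr_ge0 // ltW.
  by rewrite divfK ?gt_eqF.
rewrite mulrAC -mulrA -expr_div_n mulrC -ler_pdivrMr //; exact: ltW.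
Qed.

Lemma fast_growing_holomorphic (B : nat -> R) : exists b : R[i] -> R[i],
  (forall z, normc z < 1 -> exists l, cderiv b z l) /\
  forall k, B k <= Re (b (radius k.+1)%:C).
Proof.
have /choice[cm cmP] : forall k, exists cm : R * nat, [/\ 0 <= cm.1,
    cm.1 * radius k ^+ cm.2 <= 2^-1 ^+ k & B k <= cm.1 * radius k.+1 ^+ cm.2].
  move=> k; apply: monomial_gap; last by rewrite exprn_gt0 // invr_gt0.
  by rewrite radius_gt0 ltr_radius ltnSn.
pose a k := (cm k).1; pose m k := (cm k).2.
have a0 k : 0 <= a k by have [] := cmP k.
have a_cvg t : 0 < t < 1 -> cvgn (series (fun k => a k * t ^+ m k)).
  move=> /andP[t0 t1]; have [K tK] := radius_exhaust t1.
  pose u k := a k * t ^+ m k.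
  have u0 k : 0 <= u k by rewrite mulr_ge0 // exprn_ge0 // ltW.
  (* large enough for the first [K] terms also to lie below [C / 2 ^ k] *)
  pose C := 1 + \sum_(k < K) u k * 2 ^+ k.
  have C1 : 1 <= C by rewrite lerDl sumr_ge0 // => k _; rewrite mulr_ge0 ?exprn_ge0.
  have C0 : 0 <= C by exact: le_trans ler01 C1.
  apply: (@series_le_cvg _ _ (geometric C 2^-1)) => [k|k|k|].
  - exact: u0.
  - by rewrite mulr_ge0 ?exprn_ge0 ?invr_ge0 //.
  - rewrite /= -/(u k); have [kK|Kk] := ltnP k K.
      rewrite exprVn ler_pdivlMr ?exprn_gt0 //.
      rewrite /C (bigD1 (Ordinal kK)) //= addrCA lerDl addr_ge0 ?sumr_ge0 //.
      by move=> i _; rewrite mulr_ge0 ?exprn_ge0.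
    apply: (@le_trans _ _ (2^-1 ^+ k)); last first.
      by rewrite ler_peMl // exprn_ge0 // invr_ge0.
    have [_ + _] := cmP k; apply: le_trans; rewrite ler_wpM2l //.
    apply: lerXn2r; rewrite ?nnegrE ?(ltW t0) ?(ltW (radius_gt0 _)) //.
    apply: le_trans tK _; rewrite leNgt ltr_radius -leqNgt //.
  - by apply: is_cvg_geometric_series; rewrite ger0_norm ?invf_lt1 ?ltr1n.
exists (power_series a m); split=> [z z1|k].
  exact: power_series_cderiv.
have [_ _ Bk] := cmP k; apply: le_trans Bk _; rewrite -/(a k) -/(m k).
have r01 : 0 < radius k.+1 < 1 by rewrite radius_gt0 radius_lt1.
have := a_cvg _ r01; set u := fun k => _.
rewrite /power_series /csum /= => cu.
have -> : (fun j => Re ((a j)%:C * (radius k.+1)%:C ^+ m j)) = u.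
  by apply/funext => j; rewrite -rmorphXn -rmorphM.
have u0 j : 0 <= u j by rewrite mulr_ge0 // exprn_ge0 // ltW // radius_gt0.
apply: le_trans (nondecreasing_cvgn_le _ cu k.+1).
  by rewrite seriesSr lerDr sumr_ge0.
by apply: nondecreasing_series => j _ _; exact: u0.
Qed.

End Interpolation.

(** * The product of the disc and the plane *)
Section DiscTimesC.
Variable R : realType.
Local Notation C := (Cplx R).
Local Notation X := (disc_times_C R).

Lemma disc_times_CE (p : C * C) : X p <-> normc p.1 < 1.
Proof.
rewrite /disc_times_C /unit_disc /=; split=> [[]|h]; first by rewrite norm_mod ltcR.
by split=> //; rewrite norm_mod ltcR.
Qed.

Lemma differentiable_fst (p : C * C) : differentiable (fst : C * C -> C) p.
Proof. by apply: linear_differentiable => q; exact: cvg_fst. Qed.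

Lemma differentiable_snd (p : C * C) : differentiable (snd : C * C -> C) p.
Proof. by apply: linear_differentiable => q; exact: cvg_snd. Qed.

Lemma continuous_mod : continuous (fun z : C => normc z : R).
Proof.
move=> z; have FF : Filter (nbhs z) by exact: nbhs_filter.
apply/(@cvgrPdist_lt _ _ _ (nbhs z) FF) => e e0; apply/nbhs_modP; exists e => // w wz.
have h1 : normc w <= normc (w - z) + normc z by have := modD (w - z) z; rewrite subrK.
have h2 : normc z <= normc (w - z) + normc w.
  by rewrite mod_distC; have := modD (z - w) w; rewrite subrK.
by rewrite ltr_norml; lra.
Qed.

Lemma continuous_mod_fst : continuous (fun p : C * C => normc p.1 : R).
Proof.
move=> p; apply: (@continuous_comp _ _ _ fst (fun z : C => normc z : R)).
  exact: cvg_fst.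
exact: continuous_mod.
Qed.

Lemma continuous_mod_snd : continuous (fun p : C * C => normc p.2 : R).
Proof.
move=> p; apply: (@continuous_comp _ _ _ snd (fun z : C => normc z : R)).
  exact: cvg_snd.
exact: continuous_mod.
Qed.

Definition shear (b : C -> C) (p : C * C) : C * C := (p.1, p.2 + b p.1).

Lemma shear_holomorphic (b : C -> C) :
  (forall z : R[i], normc z < 1 -> exists l, cderiv (b : R[i] -> R[i]) z l) ->
  holomorphic_on X (shear b).
Proof.
move=> db p /disc_times_CE p1; apply: differentiable_pair.
  exact: differentiable_fst.
apply: (@differentiableD _ _ _ (snd : C * C -> C) (b \o fst)).
  exact: differentiable_snd.
apply: (@differentiable_comp _ _ _ _ (fst : C * C -> C) b); first exact: differentiable_fst.
by apply/differentiable_cderiv; exact: db.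
Qed.

Lemma shear_automorphism (b : C -> C) :
  (forall z : R[i], normc z < 1 -> exists l, cderiv (b : R[i] -> R[i]) z l) ->
  automorphism X (shear b).
Proof.
move=> db; have fX b' : set_fun X X (shear b').
  by move=> p /disc_times_CE p1; apply/disc_times_CE.
split=> //; first exact: shear_holomorphic.
exists (shear (fun z => - b z)); split=> //.
- apply: shear_holomorphic => z /db[l bl]; exists (- l) => e /bl[r r0 rP].
  exists r => // w /rP; rewrite -modN; congr (normc _ <= _); ring.
- by move=> p _; rewrite /shear /= addrK -surjective_pairing.
- by move=> p _; rewrite /shear /= subrK -surjective_pairing.
Qed.

(** On a fibre, the first coordinate of [phi] is a bounded entire function. *)
Lemma automorphism_fibres phi (z w w' : C) : automorphism X phi ->
  normc z < 1 -> (phi (z, w)).1 = (phi (z, w')).1.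
Proof.
move=> [phiX dphi _] z1.
apply: (@liouville _ (fun w : R[i] => (phi (z, w : C)).1 : R[i]) 1) => [u|u].
  apply/differentiable_cderiv.
  apply: (@differentiable_comp _ _ _ _ (fun u : C => phi (z, u)) fst).
    apply: (@differentiable_comp _ _ _ _ (fun u : C => (z, u)) phi).
      apply: differentiable_pair; first exact: differentiable_cst.
      by apply/derivable1_diffP; exact: derivable_id.
    by apply: dphi; apply/disc_times_CE.
  exact: differentiable_fst.
by apply/ltW; apply/disc_times_CE; apply: phiX; apply/disc_times_CE.
Qed.

Lemma sublevel_bounded (rho : C * C -> R) (c : R) : exhaustion X rho ->
  exists M : R, forall p, X p -> rho p <= c -> normc p.2 <= M.
Proof.
move=> [_ _ /(_ c)]; set K := X `&` _ => cK.
have [[p0 Kp0]|K0] := pselect (K !=set0); last first.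
  by exists 0 => p Xp pc; exfalso; apply: K0; exists p.
have [||p _ pM] := @compact_EVT_max _ R (fun p : C * C => normc p.2) K _ cK.
- by exists p0.
- by apply: continuous_subspaceT => p; exact: continuous_mod_snd.
by exists (normc p.2) => q Xq qc; apply: pM; rewrite inE.
Qed.

(** The shift by one matches [fast_growing_holomorphic], whose [k]-th monomial
    is small at radius [k] and large at radius [k.+1]. *)
Definition node k : C := (radius R k.+1)%:C.

Lemma mod_node k : normc (node k) = radius R k.+1.
Proof. by rewrite mod_real ger0_norm // ltW // radius_gt0. Qed.

Definition two_rows : set (C * C) :=
  [set p | exists2 k, p.1 = node k & p.2 = 0 \/ p.2 = 1].

Definition one_row : set (C * C) := range (fun k => (node k, 0 : C)).

Lemma one_row_sub : one_row `<=` two_rows.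
Proof. by move=> _ [k _ <-]; exists k => //; left. Qed.

Lemma infinite_one_row : infinite_set one_row.
Proof.
move=> fin; apply: infinite_nat.
have -> : [set: nat] = (fun k => (node k, 0 : C)) @^-1` one_row.
  by apply/seteqP; split=> k _ //; exists k.
apply: finite_preimage fin => j k _ _ [] e.
by case: (ltngtP j k) => // jk; move: jk; rewrite -ltnS -(ltr_radius R) e ltxx.
Qed.

Lemma discrete_two_rows (E : set (C * C)) : E `<=` two_rows -> discrete_in X E.
Proof.
move=> E2; split=> [p /E2[k pk _]|x /disc_times_CE x1 lim_x].
  by apply/disc_times_CE; rewrite pk mod_node radius_lt1.
pose t := (normc x.1 + 1) / 2.
have [K tK] : exists K, t <= radius R K by apply: radius_exhaust; rewrite /t; lra.
pose F := [set p | E p /\ normc p.1 < t].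
have finF : finite_set F.
  apply: (@sub_finite_set _ _ ((fun k => (node k, 0 : C)) @` `I_K `|`
    (fun k => (node k, 1 : C)) @` `I_K)).
    move=> [p1 p2] [/E2 [k /= -> p2E] pt]; have kK : (k < K)%N.
      have := lt_le_trans pt tK; rewrite mod_node ltr_radius; exact: ltnW.
    by case: p2E => ->; [left|right]; exists k.
  by rewrite finite_setU; split; apply: finite_image; exact: finite_II.
have clF : closed (F `\ x).
  have /accessible_finite_set_closed := hausdorff_accessible (@norm_hausdorff _ (C * C)%type).
  by apply; exact: finite_setD.
pose U := ~` (F `\ x) `&` [set p | normc p.1 < t].
have Ux : nbhs x U.
  apply: filterI.
    by apply: open_nbhs_nbhs; split; [exact: closed_openC|move=> [_]; exact].
  have : nbhs (normc x.1 : R) [set y | y < t].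
    by apply: open_nbhs_nbhs; split; [exact: open_lt|rewrite /= /t; lra].
  exact: continuous_mod_fst.
have [y [yx Ey [nFy yt]]] := lim_x _ Ux.
by apply: nFy; split=> //; exact/eqP.
Qed.

(** One shear serves both rows: its value at a node has a real part so large
    that the images of both points lie outside the region where [rho] is at
    most the larger of the two prescribed values. *)
Lemma tame_two_rows (E : set (C * C)) :
  E `<=` two_rows -> infinite_set E -> tame X E.
Proof.
move=> E2 infE; split=> //; first exact: discrete_two_rows.
move=> rho zeta rhoX _.
pose c k := Num.max (zeta (node k, 0)) (zeta (node k, 1)).
have /choice[M MP] : forall k, exists M : R, forall p, X p -> rho p <= c k -> normc p.2 <= M.
  by move=> k; exact: sublevel_bounded.
have [b [db bM]] := fast_growing_holomorphic (fun k => M k + 1).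
exists (shear (b : C -> C)); first exact: shear_automorphism.
move=> [_ p2] /E2 [k /= -> p2E]; rewrite leNgt; apply/negP => small.
have Xp : X (shear b (node k, p2)).
  by apply/disc_times_CE; rewrite -[(shear _ _).1]/(node k) mod_node radius_lt1.
have zc : zeta (node k, p2) <= c k.
  by rewrite /c le_max; case: p2E => ->; rewrite lexx ?orbT.
have := MP k _ Xp (ltW (lt_le_trans small zc)).
rewrite leNgt => /negP; apply; rewrite /shear /=.
have Rp2 : 0 <= Re (p2 : R[i]) by case: p2E => -> /=.
apply: lt_le_trans (Re_le_mod _); apply: lt_le_trans (ler_norm _).
by rewrite raddfD /=; have := bM k; rewrite -/(node k); lra.
Qed.

End DiscTimesC.
Arguments node : clear implicits.
Arguments two_rows : clear implicits.
Arguments one_row : clear implicits.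

Theorem corollary5p2 (R : realType) :
  exists D D' : set (Cplx R * Cplx R),
    [/\ tame (disc_times_C R) D, tame (disc_times_C R) D' &
        ~ equivalent_in (disc_times_C R) D D'].
Proof.
exists (two_rows R), (one_row R); split.
- apply: tame_two_rows => //.
  exact: sub_infinite_set (@one_row_sub R) (@infinite_one_row R).
- by apply: tame_two_rows; [exact: one_row_sub|exact: infinite_one_row].
move=> [phi aut phiD]; pose z := node R 0.
have z1 : normc z < 1 by rewrite mod_node radius_lt1.
have row p : two_rows R p -> (phi p).2 = 0.
  by move=> Dp; have [k _ <-] : one_row R (phi p) by rewrite -phiD; exists p.
have D0 : two_rows R (z, 0) by exists 0%N => //; left.
have D1 : two_rows R (z, 1) by exists 0%N => //; right.
have e : phi (z, 0) = phi (z, 1).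
  rewrite [LHS]surjective_pairing [RHS]surjective_pairing !row //.
  by rewrite (automorphism_fibres 0 1 aut z1).
have [_ _ [psi [_ _ psiK _]]] := aut.
have := congr1 psi e; rewrite !psiK ?inE; [|exact/disc_times_CE..].
by move=> [] /esym/eqP; rewrite oner_eq0.
Qed.
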